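(* Consider any fixed (deterministic) tree $\mathcal{T}\in\mathcal{S}_f$ with set of leaves $\mathcal{L}$ and any fixed outcomes $(R(x))_{x\in\mathcal{L}}\in\{0,1\}^{\mathcal{L}}$, and let $(R(x))_{x\in\mathcal{T}}$ be the corresponding minimax values. Let $m$ and $s$ be any functions on $\{(S,x):S\in\mathcal{S}_f,\ S\subset\mathcal{T},\ x\in L_S\}$ with values in $[0,1]$ and $[0,\infty)$ respectively, satisfying the following condition: for any $S\in\mathcal{S}_f$ with $S\subset\mathcal{T}$ and $\mathcal{D}_{L_S}=\emptyset$, and any $x\in L_S$, $s(S,x)=0$ if and only if $m(S,x)\in\{0,1\}$, and in such a case $m(S,x)=R(x)$. Apply the algorithm described in the context with the functions $m$ and $s$. Then: (i) For every $n\ge1$, $R_n(r)\notin\{0,1\}$ implies that $x_{n+1}\notin\mathbf{x}_n$. (ii) There is a finite $n_0\ge1$ such that $R_{n_0}(r)\in\{0,1\}$, and we then have $R_{n_0}(r)=R(r)$.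
   Context: **Trees.** $\mathbb{T}$ is the set of finite words over $\mathbb{N}_*=\{1,2,\dots\}$, seen as the complete ordered tree with root $r$ the empty word. $|x|$ is the length (depth) of $x$. The father $f(x)$ of $x\ne r$ is obtained by deleting the last letter of $x$. $\mathbb{C}_x=\{y:f(y)=x\}$; $\mathbb{T}_x$ is the set consisting of $x$ and all its descendants; $\mathbb{H}_x=\mathbb{C}_{f(x)}\setminus\{x\}$ (brothers of $x$) for $x\neq r$ and $\mathbb{H}_r=\emptyset$. For $y\in\mathbb{T}_x$, $B_{xy}=\{z\in\mathbb{T}_x: y\in\mathbb{T}_z\}$ is the branch from $x$ to $y$. $\mathbb{K}_x=\bigcup_{y\in B_{rx}}(\{y\}\cup\mathbb{H}_y)$. For $\mathbf{x}\subset\mathbb{T}$, $B_{\mathbf{x}}=\bigcup_{x\in\mathbf{x}}B_{rx}$ and $\mathbb{D}_{\mathbf{x}}=(\bigcup_{x\in B_{\mathbf{x}}}\mathbb{H}_x)\setminus B_{\mathbf{x}}$. $\mathcal{S}_f$ is the set of finite subtrees of $\mathbb{T}$ with root $r$ (finite $T\ni r$ with $B_{rx}\subset T$ for all $x\in T$). For $T\in\mathcal{S}_f$, $L_T=\{x\in T:T\cap\mathbb{T}_x=\{x\}\}$ is its set of leaves. **Game.** For the game tree $\mathcal{T}\in\mathcal{S}_f$ with leaves $\mathcal{L}=L_{\mathcal{T}}$, write $\mathcal{C}_x=\mathcal{T}\cap\mathbb{C}_x$, $\mathcal{H}_x=\mathcal{T}\cap\mathbb{H}_x$, $\mathcal{K}_x=\mathcal{T}\cap\mathbb{K}_x$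 for $x\in\mathcal{T}$, and $\mathcal{D}_{\mathbf{x}}=\mathcal{T}\cap\mathbb{D}_{\mathbf{x}}$ for $\mathbf{x}\subset\mathcal{T}$. Set $t(x)=1$ if $|x|$ is even and $t(x)=0$ if $|x|$ is odd. Minimax values: for $x\in\mathcal{T}\setminus\mathcal{L}$, $R(x)=\min_{y\in\mathcal{C}_x}R(y)$ if $t(x)=0$ and $R(x)=\max_{y\in\mathcal{C}_x}R(y)$ if $t(x)=1$. A *uniformly random match* starting from $x\in\mathcal{T}$ goes down from $x$, choosing at each step uniformly among the children in $\mathcal{T}$ of the current node, until a leaf of $\mathcal{T}$ (the resulting leaf) is reached. **Algorithm (with parameter functions $m,s$, run without any a priori bound on the number of iterations).** It produces leaves $x_1,x_2,\dots$ and sets $\mathbf{x}_n=\{x_1,\dots,x_n\}$. Step 1: simulate a uniformly random match from $r$, with resulting leaf $x_1$. After $n$ steps, the following quantities are defined by backward induction on $B_{\mathbf{x}_n}\cup\mathcal{D}_{\mathbf{x}_n}$: - if $x\in\mathbf{x}_n$: $R_n(x)=R(x)$ and $Z_n(x)=0$; - if $x\in\mathcal{D}_{\mathbf{x}_n}$: $R_n(x)=m(\mathcal{K}_x,x)$ and $Z_n(x)=s(\mathcal{K}_x,x)$; - if $x\in B_{\mathbf{x}_n}\setminus\mathbf{x}_n$: $R_n(x)=\prod_{y\in\mathcal{C}_x}R_n(y)$ if $t(x)=0$ and $R_n(x)=1-\prod_{y\in\mathcal{C}_x}(1-R_n(y))$ if $t(x)=1$; and $Z_n(x)=\max\{(U_n(y))^2Z_n(y):y\in\mathcal{C}_x\}$;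 - where, for $x\in(B_{\mathbf{x}_n}\cup\mathcal{D}_{\mathbf{x}_n})\setminus\{r\}$, $U_n(x)=\prod_{y\in\mathcal{H}_x}R_n(y)$ if $t(f(x))=0$ and $U_n(x)=\prod_{y\in\mathcal{H}_x}(1-R_n(y))$ if $t(f(x))=1$. Step $n+1$ (if $n\ge 2$ and $R_n(r)\in\{0,1\}$ the algorithm stops instead): put $z=r$ and, until $z\in\mathbf{x}_n\cup\mathcal{D}_{\mathbf{x}_n}$, replace $z$ by $\arg\max\{(U_n(y))^2Z_n(y):y\in\mathcal{C}_z\}$ (ties broken e.g. uniformly at random). Call $z_n$ the final $z$. If $z_n\in\mathbf{x}_n$, set $x_{n+1}=z_n$. If $z_n\in\mathcal{D}_{\mathbf{x}_n}$, simulate a uniformly random match from $z_n$ and call $x_{n+1}$ the resulting leaf. *)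

(* Defs.v *)
From HB Require Import structures.
From mathcomp Require Import all_boot all_order all_algebra finmap.
From mathcomp Require Import all_classical all_reals all_analysis.

Set Implicit Arguments.
Unset Strict Implicit.
Unset Printing Implicit Defensive.
Import Order.TTheory GRing.Theory Num.Theory.
Local Open Scope ring_scope.

Notation word := (seq {n : nat | (0 < n)%N}).
Definition rootnode : word := [::].

(* Deletes the last letter; only meaningful for x != rootnode. *)
Definition father (x : word) : word := take (size x).-1 x.

(* [childof x y]: y is a child of x. *)
Definition childof (x y : word) : bool := (y != rootnode) && (father y == x).

(* [brother x y]: y is a brother of x; the root has none. *)
Definition brother (x y : word) : bool :=
  [&& x != rootnode, childof (father x) y & y != x].

(* Reflexive: y is x or a proper descendant of x. *)
Definition descendant (x y : word) : bool := prefix x y.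

Definition ancestors (y : word) : {fset word} :=
  [fset take k y | k in iota 0 (size y).+1]%fset.

(* B_{xy}, the branch from x to y (empty if y is not below x) *)
Definition branch (x y : word) : {fset word} :=
  [fset z in ancestors y | descendant x z && descendant z y]%fset.

(* B_{xs}, the union of the branches from the root to the elements of xs *)
Definition branches (xs : {fset word}) : {fset word} :=
  (\bigcup_(x <- xs) branch rootnode x)%fset.

(* Membership of z in the infinite-tree sets K_x and D_{xs}. *)
Definition in_K (x z : word) : bool :=
  has (fun y => (z == y) || brother y z) (branch rootnode x).
Definition in_D (xs : {fset word}) (z : word) : bool :=
  has (fun x => brother x z) (branches xs) && (z \notin branches xs).

(* S is a finite subtree containing the root. *)
Definition is_subtree (S : {fset word}) : Prop :=
  rootnode \in S /\ forall x, x \in S -> (branch rootnode x `<=` S)%fset.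

Definition leaves (S : {fset word}) : {fset word} :=
  [fset x in S | [fset y in S | descendant x y] == [fset x]]%fset.

Definition Cset (T : {fset word}) (x : word) : {fset word} :=
  [fset y in T | childof x y]%fset.
Definition Hset (T : {fset word}) (x : word) : {fset word} :=
  [fset y in T | brother x y]%fset.
Definition Kset (T : {fset word}) (x : word) : {fset word} :=
  [fset y in T | in_K x y]%fset.
Definition Dset (T xs : {fset word}) : {fset word} :=
  [fset y in T | in_D xs y]%fset.

(* The node x is at even depth: the player to move maximizes. *)
Definition t (x : word) : bool := ~~ odd (size x).

(* All the backward inductions below are recursions on [levels_below T x], which
   bounds the length of any descent from x inside T: for a child y of x in T,
   levels_below T x = (levels_below T y).+1.  So the value returned when that
   number is exhausted is only ever used at nodes without children.  The
   equations are recorded after the definitions. *)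
Definition levels_below (T : {fset word}) (x : word) : nat :=
  (\max_(y <- T) size y - size x)%N.

(* The default values 0 of the maxima and 1 of the minima are harmless: leaf
   outcomes are in {0, 1}, and internal nodes have children. *)
Fixpoint minimax_rec (R : realType) (T : {fset word}) (o : word -> R)
    (k : nat) (x : word) : R :=
  if x \in leaves T then o x else
  if k is k'.+1 then
    if t x then \big[Num.max/0]_(y <- Cset T x) minimax_rec T o k' y
    else \big[Num.min/1]_(y <- Cset T x) minimax_rec T o k' y
  else 0.
Definition minimax (R : realType) (T : {fset word}) (o : word -> R) (x : word)
  : R := minimax_rec T o (levels_below T x) x.

(* [match_law T x y]: the probability that a uniformly random match starting
   from x ends at y. *)
Fixpoint match_law_rec (R : realType) (T : {fset word}) (k : nat)
    (x y : word) : R :=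
  if x \in leaves T then (x == y)%:R else
  if k is k'.+1 then
    \sum_(c <- Cset T x) (#|` Cset T x|%:R)^-1 * match_law_rec R T k' c y
  else 0.
Definition match_law (R : realType) (T : {fset word}) (x y : word) : R :=
  match_law_rec R T (levels_below T x) x y.

Fixpoint Rn_rec (R : realType) (T : {fset word}) (o : word -> R)
    (m : {fset word} -> word -> R) (xs : {fset word}) (k : nat) (x : word) : R :=
  if x \in xs then minimax T o x else
  if x \in Dset T xs then m (Kset T x) x else
  if k is k'.+1 then
    if t x then 1 - \prod_(y <- Cset T x) (1 - Rn_rec T o m xs k' y)
    else \prod_(y <- Cset T x) Rn_rec T o m xs k' y
  else 0.
Definition Rn (R : realType) (T : {fset word}) (o : word -> R)
    (m : {fset word} -> word -> R) (xs : {fset word}) (x : word) : R :=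
  Rn_rec T o m xs (levels_below T x) x.

Definition Un (R : realType) (T : {fset word}) (o : word -> R)
    (m : {fset word} -> word -> R) (xs : {fset word}) (x : word) : R :=
  if t (father x) then \prod_(y <- Hset T x) (1 - Rn T o m xs y)
  else \prod_(y <- Hset T x) Rn T o m xs y.

(* The default value 0 of the maximum is harmless since s is nonnegative. *)
Fixpoint Zn_rec (R : realType) (T : {fset word}) (o : word -> R)
    (m s : {fset word} -> word -> R) (xs : {fset word}) (k : nat) (x : word)
    : R :=
  if x \in xs then 0 else
  if x \in Dset T xs then s (Kset T x) x else
  if k is k'.+1 then
    \big[Num.max/0]_(y <- Cset T x) (Un T o m xs y ^+ 2 * Zn_rec T o m s xs k' y)
  else 0.
Definition Zn (R : realType) (T : {fset word}) (o : word -> R)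
    (m s : {fset word} -> word -> R) (xs : {fset word}) (x : word) : R :=
  Zn_rec T o m s xs (levels_below T x) x.

Lemma size_father (x : word) : x != rootnode -> size x = (size (father x)).+1.
Proof.
rewrite /father; case: x => [//|a x _].
by rewrite size_take /= leqnn.
Qed.

Lemma levels_below_child (T : {fset word}) (x y : word) :
  y \in Cset T x -> levels_below T x = (levels_below T y).+1.
Proof.
rewrite !inE /= /levels_below => /and3P[yT /size_father sy /eqP <-].
have : (size y <= \max_(z <- T) size z)%N by apply: leq_bigmax_seq.
by rewrite sy => h; rewrite -subSn// subSS.
Qed.

Lemma child_notin_leaves (T : {fset word}) (x : word) :
  Cset T x != fset0 -> x \notin leaves T.
Proof.
move=> /fset0Pn[y]; rewrite !inE /= => /and3P[yT yr /eqP yx].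
apply/negP => /andP[xT /eqP /fsetP /(_ y)]; rewrite !inE /= yT /=.
rewrite {1}/descendant -yx /father prefix_take /= => /esym /eqP yf.
by have := size_father yr; rewrite /father -yf => /n_Sn.
Qed.

Lemma leavesE (T : {fset word}) (x : word) : is_subtree T -> x \in T ->
  (x \in leaves T) = (Cset T x == fset0).
Proof.
move=> [_ subT] xT; apply/idP/idP; first by
  apply: contraLR => /child_notin_leaves.
move=> /eqP C0; rewrite !inE xT /=; apply/eqP/fsetP => y; rewrite !inE /=.
apply/andP/eqP => [[yT]|->]; last by rewrite xT; split=> //; apply: prefix_refl.
move=> /prefixP[[|a u] yxu]; first by rewrite yxu cats0.
have : rcons x a \in Cset T x; last by rewrite C0 inE.
rewrite !inE /= /childof /father size_rcons /= -cats1 take_size_cat // eqxx.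
have -> /= : (x ++ [:: a] != rootnode) by case: (x).
rewrite !andbT; apply: (fsubsetP (subT _ yT)); rewrite !inE /=.
have pfx : prefix (x ++ [:: a]) y by rewrite yxu -cat_rcons -cats1 prefix_prefix.
rewrite /descendant pfx prefix0s !andbT.
apply/imfsetP; exists (size (x ++ [:: a])).
  by rewrite /= -/(iota 0 (size y).+1) mem_iota add0n ltnS; exact: size_prefix.
by move: pfx; rewrite prefixE => /eqP.
Qed.

Lemma minimax_leaf (R : realType) (T : {fset word}) (o : word -> R) (x : word) :
  x \in leaves T -> minimax T o x = o x.
Proof. by rewrite /minimax; case: levels_below => [|k] /= ->. Qed.

Lemma minimax_node (R : realType) (T : {fset word}) (o : word -> R) (x : word) :
  Cset T x != fset0 ->
  minimax T o x = if t x then \big[Num.max/0]_(y <- Cset T x) minimax T o y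
                  else \big[Num.min/1]_(y <- Cset T x) minimax T o y.
Proof.
move=> Cx; have /fset0Pn[c cC] := Cx.
rewrite {1}/minimax (levels_below_child cC) /=.
rewrite (negbTE (child_notin_leaves Cx)).
by congr (if _ then _ else _); rewrite big_seq [RHS]big_seq;
  apply: eq_bigr => y yC; rewrite /minimax;
  move: (levels_below_child cC); rewrite (levels_below_child yC) => -[->].
Qed.

Lemma match_law_leaf (R : realType) (T : {fset word}) (x y : word) :
  x \in leaves T -> match_law R T x y = (x == y)%:R.
Proof. by rewrite /match_law; case: levels_below => [|k] /= ->. Qed.

Lemma match_law_node (R : realType) (T : {fset word}) (x y : word) :
  Cset T x != fset0 ->
  match_law R T x y =
  \sum_(c <- Cset T x) (#|` Cset T x|%:R)^-1 * match_law R T c y.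
Proof.
move=> Cx; have /fset0Pn[c cC] := Cx.
rewrite {1}/match_law (levels_below_child cC) /=.
rewrite (negbTE (child_notin_leaves Cx)) big_seq [RHS]big_seq.
apply: eq_bigr => z zC; rewrite /match_law.
by move: (levels_below_child cC); rewrite (levels_below_child zC) => -[->].
Qed.

Lemma Rn_visited (R : realType) (T : {fset word}) (o : word -> R)
    (m : {fset word} -> word -> R) (xs : {fset word}) (x : word) :
  x \in xs -> Rn T o m xs x = minimax T o x.
Proof. by rewrite /Rn; case: levels_below => [|k] /= ->. Qed.

Lemma Rn_D (R : realType) (T : {fset word}) (o : word -> R)
    (m : {fset word} -> word -> R) (xs : {fset word}) (x : word) :
  x \notin xs -> x \in Dset T xs -> Rn T o m xs x = m (Kset T x) x.
Proof. by rewrite /Rn => /negbTE xxs; case: levels_below => [|k] /= ->; rewrite xxs. Qed.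

Lemma Rn_node (R : realType) (T : {fset word}) (o : word -> R)
    (m : {fset word} -> word -> R) (xs : {fset word}) (x : word) :
  x \notin xs -> x \notin Dset T xs -> Cset T x != fset0 ->
  Rn T o m xs x = if t x then 1 - \prod_(y <- Cset T x) (1 - Rn T o m xs y)
                  else \prod_(y <- Cset T x) Rn T o m xs y.
Proof.
move=> /negbTE xxs /negbTE xD /fset0Pn[c cC].
rewrite {1}/Rn (levels_below_child cC) /= xxs xD.
by congr (if _ then 1 - _ else _); rewrite big_seq [RHS]big_seq;
  apply: eq_bigr => y yC; rewrite /Rn;
  move: (levels_below_child cC); rewrite (levels_below_child yC) => -[->].
Qed.

Lemma Zn_visited (R : realType) (T : {fset word}) (o : word -> R)
    (m s : {fset word} -> word -> R) (xs : {fset word}) (x : word) :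
  x \in xs -> Zn T o m s xs x = 0.
Proof. by rewrite /Zn; case: levels_below => [|k] /= ->. Qed.

Lemma Zn_D (R : realType) (T : {fset word}) (o : word -> R)
    (m s : {fset word} -> word -> R) (xs : {fset word}) (x : word) :
  x \notin xs -> x \in Dset T xs -> Zn T o m s xs x = s (Kset T x) x.
Proof. by rewrite /Zn => /negbTE xxs; case: levels_below => [|k] /= ->; rewrite xxs. Qed.

Lemma Zn_node (R : realType) (T : {fset word}) (o : word -> R)
    (m s : {fset word} -> word -> R) (xs : {fset word}) (x : word) :
  x \notin xs -> x \notin Dset T xs -> Cset T x != fset0 ->
  Zn T o m s xs x =
  \big[Num.max/0]_(y <- Cset T x) (Un T o m xs y ^+ 2 * Zn T o m s xs y).
Proof.
move=> /negbTE xxs /negbTE xD /fset0Pn[c cC].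
rewrite {1}/Zn (levels_below_child cC) /= xxs xD big_seq [RHS]big_seq.
apply: eq_bigr => y yC; rewrite /Zn.
by move: (levels_below_child cC); rewrite (levels_below_child yC) => -[->].
Qed.

(* [selects T o m s xs z w]: following the argmax of U^2 Z downwards from z, the
   first node met in xs or D_xs can be w.  It is a relation because ties may be
   broken in any way. *)
Inductive selects (R : realType) (T : {fset word}) (o : word -> R)
    (m s : {fset word} -> word -> R) (xs : {fset word}) : word -> word -> Prop :=
| selects_stop z :
    z \in xs \/ z \in Dset T xs -> selects T o m s xs z z
| selects_step z y w :
    ~ (z \in xs \/ z \in Dset T xs) ->
    y \in Cset T z ->
    (forall y', y' \in Cset T z ->
       Un T o m xs y' ^+ 2 * Zn T o m s xs y'
       <= Un T o m xs y ^+ 2 * Zn T o m s xs y) ->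
    selects T o m s xs y w -> selects T o m s xs z w.

Definition in01 (R : realType) (v : R) : Prop := v = 0 \/ v = 1.

(* {x_1, ..., x_n} *)
Definition visited (x : nat -> word) (n : nat) : {fset word} :=
  [fset x k | k in iota 1 n]%fset.

(* The algorithm with successive leaves x_1, x_2, ... gets to perform step n,
   i.e. it has not stopped before producing x_n. *)
Definition performed (R : realType) (T : {fset word}) (o : word -> R)
    (m : {fset word} -> word -> R) (x : nat -> word) (n : nat) : Prop :=
  forall k, (2 <= k < n)%N -> ~ in01 (Rn T o m (visited x k) rootnode).

(* [X w n] is the leaf x_n and [Z w n] the node z_n selected at step n+1, in the
   realization w; indices start at 1, and the values attached to steps that are
   not performed are unconstrained.  The last two fields say that the match
   simulated at a step has the law of a uniformly random match, conditionally on
   everything that happened before. *)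
Record is_algorithm (R : realType) (d : measure_display)
    (Omega : measurableType d) (P : probability Omega R)
    (T : {fset word}) (o : word -> R) (m s : {fset word} -> word -> R)
    (X Z : Omega -> nat -> word) : Prop := IsAlgorithm {
  alg_measurable_X : forall n u, measurable [set w | X w n = u]%classic;
  alg_measurable_Z : forall n u, measurable [set w | Z w n = u]%classic;
  alg_first : forall w, X w 1 \in leaves T;
  alg_select : forall w n, (1 <= n)%N -> performed T o m (X w) n.+1 ->
    selects T o m s (visited (X w) n) rootnode (Z w n);
  alg_again : forall w n, (1 <= n)%N -> performed T o m (X w) n.+1 ->
    Z w n \in visited (X w) n -> X w n.+1 = Z w n;
  alg_match : forall w n, (1 <= n)%N -> performed T o m (X w) n.+1 ->
    Z w n \in Dset T (visited (X w) n) ->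
    X w n.+1 \in leaves T /\ descendant (Z w n) (X w n.+1);
  alg_first_law : forall y,
    P [set w | X w 1 = y]%classic = (match_law R T rootnode y)%:E;
  alg_match_law : forall n (a b : nat -> word) y,
    (1 <= n)%N -> performed T o m a n.+1 -> b n \in Dset T (visited a n) ->
    let past :=
      [set w | forall k, (1 <= k <= n)%N -> X w k = a k /\ Z w k = b k]%classic in
    P (past `&` [set w | X w n.+1 = y])%classic
    = (P past * (match_law R T (b n) y)%:E)%E }.

(* Main.v *)
(* Call a node of B u D decided when R_n is 0 or 1 there.  By backward
   induction, Z_n >= 0 vanishes exactly at the decided nodes, and R_n is the true
   minimax value there.  At an internal node this holds because, up to replacing
   every value v by 1 - v, R_n(x) is the product of the R_n(y) and U_n(y) is that
   product with the factor at y removed.  At a node x of D it is the hypothesis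
   on m and s, applied to K_x, which is closed under brothers and has x as a
   leaf.  Hence if the root is undecided, the argmax descent only meets undecided
   nodes, so it ends in D, above no visited leaf, and the next leaf is new; this
   can happen only finitely many times. *)

Require Import Defs.
From mathcomp Require Import all_boot all_order all_algebra finmap.
From mathcomp Require Import all_classical all_reals all_analysis.
Set Implicit Arguments.
Unset Strict Implicit.
Unset Printing Implicit Defensive.
Import Order.TTheory GRing.Theory Num.Theory.
Local Open Scope ring_scope.

(** * Prefixes, branches and subtrees *)

Lemma prefix_father (x : word) : prefix (father x) x.
Proof. exact: prefix_take. Qed.

Lemma prefix_proper_father (x y : word) :
  prefix x y -> x != y -> prefix x (father y).
Proof.
move=> /prefixP[u ->]; case/lastP: u => [|u a]; first by rewrite cats0 eqxx.
move=> _; rewrite /father -rcons_cat size_rcons -cats1 take_size_cat //.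
exact: prefix_prefix.
Qed.

Lemma child_towards (x y : word) :
  prefix x y -> x != y -> exists2 c, childof x c & prefix c y.
Proof.
move=> /prefixP[[|a u] ->]; first by rewrite cats0 eqxx.
move=> _; exists (rcons x a); last by rewrite -cat_rcons prefix_prefix.
by rewrite /childof /father size_rcons -cats1 take_size_cat // eqxx; case: (x).
Qed.

Lemma mem_branch_root (z y : word) : (z \in branch rootnode y) = prefix z y.
Proof.
rewrite /branch !inE /= /descendant prefix0s /=; apply/andP/idP => [[]//|zy].
split=> //; apply/imfsetP; exists (size z).
  by rewrite /= -/(iota 0 (size y).+1) mem_iota add0n ltnS; exact: size_prefix.
by move: zy; rewrite prefixE => /eqP.
Qed.

Lemma mem_branches (xs : {fset word}) (z : word) :
  reflect (exists2 x, x \in xs & prefix z x) (z \in branches xs).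
Proof.
apply: (iffP (bigfcupP _ _ _ _)) => -[x xxs zx]; exists x => //.
- by case/andP: xxs.
- by rewrite -mem_branch_root.
- by rewrite xxs.
- by rewrite mem_branch_root.
Qed.

Lemma mem_branches_root (xs : {fset word}) (x : word) :
  x \in xs -> rootnode \in branches xs.
Proof. by move=> xxs; apply/mem_branches; exists x => //; apply: prefix0s. Qed.

Lemma mem_Cset (T : {fset word}) (x y : word) :
  (y \in Cset T x) = (y \in T) && childof x y.
Proof. by rewrite !inE. Qed.

Lemma mem_Dset (T xs : {fset word}) (z : word) :
  reflect [/\ z \in T, z \notin branches xs &
             exists2 x, x \in branches xs & brother x z]
          (z \in Dset T xs).
Proof.
rewrite !inE /= /in_D; apply: (iffP andP) => [[zT]|[zT zB [x xB xz]]].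
  by case/andP => /hasP[x xB xz] zB; split => //; exists x.
by rewrite zT zB andbT; split=> //; apply/hasP; exists x.
Qed.

Lemma brotherE (x y : word) :
  brother x y =
  [&& x != rootnode, y != rootnode, father y == father x & y != x].
Proof. by rewrite /brother /childof -!andbA. Qed.

Lemma subtree_prefix (S : {fset word}) (x y : word) :
  is_subtree S -> y \in S -> prefix x y -> x \in S.
Proof.
by move=> [_ /(_ y) subS] /subS /fsubsetP H xy; apply: H; rewrite mem_branch_root.
Qed.

Lemma childof_root_neq (x y : word) : childof x y -> y != rootnode.
Proof. by case/andP. Qed.

Lemma childof_father (x y : word) : childof x y -> father y = x.
Proof. by case/andP => _ /eqP. Qed.

Lemma leaf_below (S : {fset word}) (x : word) :
  is_subtree S -> x \in S -> exists2 l, l \in leaves S & prefix x l.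
Proof.
move=> hS; have [k] := ubnP (levels_below S x).
elim: k x => // k IH x; rewrite ltnS => lk xS.
have [C0|/fset0Pn[c cC]] := eqVneq (Cset S x) fset0.
  by exists x; rewrite ?prefix_refl // leavesE // C0.
have cS : c \in S by move: cC; rewrite mem_Cset => /andP[].
have [|//|l lS cl] := IH c; first by rewrite -(levels_below_child cC).
exists l => //; apply: prefix_trans cl.
by move: cC; rewrite mem_Cset => /andP[_ /childof_father <-]; apply: prefix_father.
Qed.

Lemma leaf_mem (S : {fset word}) (x : word) : x \in leaves S -> x \in S.
Proof. by rewrite !inE => /andP[]. Qed.

(** * The sets K_x *)

(** Apart from the root, K_x consists of the children of the proper ancestors of x. Membership of a
    non-root z thus depends on [father z] alone, which makes stability under brothers immediate. *)
Lemma in_KE (x z : word) :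
  in_K x z = (z == rootnode) || prefix (father z) x && (father z != x).
Proof.
have father_neq u v : u != rootnode -> prefix u v -> father u != v.
  move=> ur /size_prefix uv; apply/eqP => fuv; move: uv.
  by rewrite -fuv (size_father ur) ltnn.
rewrite /in_K; apply/hasP/idP => [[y]|].
  have [//|zr] := eqVneq z rootnode; rewrite mem_branch_root.
  move=> yx /orP[/eqP zy|]; last rewrite brotherE => /and4P[yr _ /eqP -> _].
    rewrite zy in zr *; rewrite father_neq // andbT.
    exact: prefix_trans (prefix_father _) yx.
  by rewrite father_neq // (prefix_trans (prefix_father y)).
case/predU1P => [->|/andP[fzx fz_neq]].
  by exists rootnode; rewrite ?mem_branch_root ?prefix0s // eqxx.
have [->|zr] := eqVneq z rootnode.
  by exists rootnode; rewrite ?mem_branch_root ?prefix0s // eqxx.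
(* The child [c] of [father z] towards x lies on the branch to x, and z is either [c] or one of its
   brothers. *)
have [c cf cx] := child_towards fzx fz_neq.
exists c; first by rewrite mem_branch_root.
have [//|zc /=] := eqVneq z c.
by rewrite brotherE zr zc (childof_root_neq cf) (childof_father cf) eqxx.
Qed.

Lemma mem_Kset (T : {fset word}) (x z : word) :
  (z \in Kset T x) = (z \in T) && in_K x z.
Proof. by rewrite !inE. Qed.

Lemma Kset_sub (T : {fset word}) (x : word) : (Kset T x `<=` T)%fset.
Proof. by apply/fsubsetP => z; rewrite mem_Kset => /andP[]. Qed.

Lemma Kset_subtree (T : {fset word}) (x : word) :
  is_subtree T -> is_subtree (Kset T x).
Proof.
move=> hT; split; first by rewrite mem_Kset in_KE eqxx andbT; case: hT.
move=> z; rewrite mem_Kset => /andP[zT zK]; apply/fsubsetP => p.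
rewrite mem_branch_root => pz; rewrite mem_Kset (subtree_prefix hT zT pz) /=.
(* A proper ancestor [p] of z is above [father z], hence above x; its own father is then strictly
   shorter than x. *)
have [->//|p_neq] := eqVneq p z.
move: zK; rewrite !in_KE; have [//|pr] := eqVneq p rootnode.
case/predU1P => [zr|/andP[fzx fz_neq]].
  by move: pz pr; rewrite zr prefixs0 => ->.
have pfz := prefix_proper_father pz p_neq.
have px := prefix_trans pfz fzx.
rewrite (prefix_trans (prefix_father _) px) /=.
by apply/eqP => fpx; move: (size_prefix px); rewrite -fpx (size_father pr) ltnn.
Qed.

(** A child of x has x itself as father, and x is not a proper ancestor of x. *)
Lemma leaf_Kset (T : {fset word}) (x : word) :
  is_subtree T -> x \in T -> x \in leaves (Kset T x).
Proof.
move=> hT xT; have hK := Kset_subtree x hT.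
have xK : x \in Kset T x.
  rewrite mem_Kset xT in_KE /=; have [//|xr] := eqVneq x rootnode.
  rewrite prefix_father /=; apply/eqP => /(congr1 size).
  by rewrite [in RHS](size_father xr) => /n_Sn.
rewrite leavesE //; apply/eqP/fsetP => z; rewrite mem_Cset mem_Kset in_KE in_fset0.
apply/negP => /andP[/andP[_ zK] /andP[zr /eqP fz]].
by move: zK; rewrite (negbTE zr) fz eqxx andbF.
Qed.

(** Any node of K_x lies above a leaf of K_x, so the branches to these leaves fill K_x, which is
    closed under brothers. This is the side condition under which the hypothesis relating m and s
    can be applied to K_x. *)
Lemma Dset_leaves_Kset (T : {fset word}) (x : word) :
  is_subtree T -> Dset T (leaves (Kset T x)) = fset0.
Proof.
move=> hT; have hK := Kset_subtree x hT.
apply/fsetP => y; rewrite in_fset0; apply/negP => /mem_Dset[yT yB [z zB zy]].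
case/mem_branches: zB => l /leaf_mem lK zl.
have := subtree_prefix hK lK zl; rewrite mem_Kset in_KE => /andP[_].
move: zy; rewrite brotherE => /and4P[/negbTE -> yr /eqP fy _] /= zK.
have yK : y \in Kset T x by rewrite mem_Kset yT in_KE fy zK orbT.
have [l' l'K yl'] := leaf_below hK yK.
by case/negP: yB; apply/mem_branches; exists l'.
Qed.

(** * The explored region B u D *)

(** A visited node lies strictly below x, so the child [c] of x towards it is on a branch, and any
    other child of x is a brother of [c]. Backward induction and the argmax descent therefore never
    leave B u D. *)
Lemma branches_child (T xs : {fset word}) (x : word) :
  is_subtree T -> {subset xs <= T} -> x \in branches xs -> x \notin xs ->
  [/\ x \notin Dset T xs, Cset T x != fset0 &
    forall y, y \in Cset T x -> y \in branches xs \/ y \in Dset T xs].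
Proof.
move=> hT xsT xB xxs; have [l lxs xl] := mem_branches _ _ xB.
have xl_neq : x != l by apply: contraNneq xxs => ->.
have [c cx cl] := child_towards xl xl_neq.
have cB : c \in branches xs by apply/mem_branches; exists l.
split.
- by apply/negP => /mem_Dset[_ /negP].
- apply/fset0Pn; exists c.
  by rewrite mem_Cset cx (subtree_prefix hT (xsT _ lxs) cl).
- move=> y; rewrite mem_Cset => /andP[yT yx].
  have [|yB] := boolP (y \in branches xs); [by left|right].
  apply/mem_Dset; split=> //; exists c => //.
  rewrite brotherE (childof_root_neq cx) (childof_root_neq yx).
  rewrite (childof_father cx) (childof_father yx) eqxx /=.
  by apply: contraNneq yB => ->.
Qed.

Lemma Hset_child (T : {fset word}) (x y : word) :
  y \in Cset T x -> Hset T y = (Cset T x `\ y)%fset.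
Proof.
rewrite mem_Cset => /andP[yT yx]; apply/fsetP => z.
rewrite in_fsetD1 mem_Cset !inE /= brotherE (childof_root_neq yx).
by rewrite (childof_father yx) /childof; case: (z \in T) => //=; rewrite ?andbF //;
  case: (z == y); rewrite ?andbF ?andbT.
Qed.

Lemma sub_branches_D (T xs : {fset word}) (x : word) :
  is_subtree T -> {subset xs <= T} ->
  x \in branches xs \/ x \in Dset T xs -> x \in T.
Proof.
move=> hT xsT [/mem_branches[l /xsT lT]|/mem_Dset[]//].
exact: subtree_prefix.
Qed.

(** * Reversing values at maximizing nodes *)

(* The minimax recursion and that of R_n become plain products after the change
   of variable [toward (t x)]. *)
Definition toward (R : realType) (b : bool) (v : R) : R := if b then 1 - v else v.

Lemma towardK (R : realType) (b : bool) : involutive (@toward R b).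
Proof. by move=> v; case: b => //=; rewrite opprB addrC subrK. Qed.

Lemma toward_in01 (R : realType) (b : bool) (v : R) :
  in01 (toward b v) <-> in01 v.
Proof.
have in01N u : in01 u -> in01 (toward b u).
  by case: b => //= -[->|->]; [right; rewrite subr0|left; rewrite subrr].
by split=> /in01N //; rewrite towardK.
Qed.

Lemma toward_itv (R : realType) (b : bool) (v : R) :
  0 <= v <= 1 -> 0 <= toward b v <= 1.
Proof. by case: b => //= /andP[v0 v1]; rewrite subr_ge0 v1 gerBl v0. Qed.

Lemma in01_itv (R : realType) (v : R) : in01 v -> 0 <= v <= 1.
Proof. by case=> ->; rewrite lexx ler01. Qed.

(** * Products and maxima over finite sets of nodes *)

Section FsetProducts.
Context {R : realType} {A : {fset word}}.
Implicit Types F G : word -> R.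

Lemma fset_prod_itv G :
  (forall y, y \in A -> 0 <= G y <= 1) -> 0 <= \prod_(y <- A) G y <= 1.
Proof.
move=> G01; rewrite big_seq prodr_ile1 // andbT prodr_ge0 // => y /G01.
by case/andP.
Qed.

Lemma fset_prod_eq0 G :
  \prod_(y <- A) G y = 0 -> exists2 y, y \in A & G y = 0.
Proof.
by move/eqP; rewrite prodf_seq_eq0 => /hasP[y yA /= /eqP]; exists y.
Qed.

Lemma fset_prod_zero G y : y \in A -> G y = 0 -> \prod_(y <- A) G y = 0.
Proof. by move=> yA Gy; rewrite (big_fsetD1 y) //= Gy mul0r. Qed.

Lemma fset_prod_one G :
  (forall y, y \in A -> G y = 1) -> \prod_(y <- A) G y = 1.
Proof. by move=> G1; rewrite big_seq big1. Qed.

Lemma fset_prod_in01 G :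
  (forall y, y \in A -> in01 (G y)) -> in01 (\prod_(y <- A) G y).
Proof.
move=> G01; have [/existsP[[y yA] /= /eqP Gy]|] :=
  boolP [exists y : A, G (val y) == 0].
  by left; apply: (fset_prod_zero yA).
rewrite negb_exists => /forallP G0; right; apply: fset_prod_one => y yA.
by have /eqP := G0 [` yA]%fset; case: (G01 y yA).
Qed.

Lemma fset_bigmax_eq0 F :
  (forall y, y \in A -> 0 <= F y) ->
  \big[Num.max/0]_(y <- A) F y = 0 <-> forall y, y \in A -> F y = 0.
Proof.
move=> F0; split=> [max0 y yA|Fz].
  apply/eqP; rewrite eq_le F0 // andbT -max0.
  exact: (le_bigmax_seq 0 y xpredT).
by rewrite big_seq; elim/big_ind: _ => // u v -> ->; rewrite maxxx.
Qed.

End FsetProducts.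

(** Each factor is at least the whole product, since the other factors multiply to at most 1. *)
Lemma fset_prod_eq1 (R : realType) (A : {fset word}) (G : word -> R) :
  (forall y, y \in A -> 0 <= G y <= 1) -> \prod_(y <- A) G y = 1 ->
  forall y, y \in A -> G y = 1.
Proof.
move=> G01 prod1 y yA; have /andP[Gy0 Gy1] := G01 y yA.
apply/eqP; rewrite eq_le Gy1 /= -prod1 (big_fsetD1 y) //= ler_piMr //.
have /fset_prod_itv/andP[_ //] : forall z, z \in (A `\ y)%fset -> 0 <= G z <= 1.
by move=> z; rewrite in_fsetD1 => /andP[_ /G01].
Qed.

(** A product 0 is settled by a single zero factor, whatever the undecided ones are; a product 1
    forces every factor to be 1. In both cases only factors on which G and H agree matter. *)
Lemma fset_prod_in01_transfer (R : realType) (A : {fset word})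
    (G H : word -> R) :
  (forall y, y \in A -> 0 <= G y <= 1) ->
  (forall y, y \in A -> in01 (G y) -> G y = H y) ->
  in01 (\prod_(y <- A) G y) -> \prod_(y <- A) G y = \prod_(y <- A) H y.
Proof.
move=> G01 GH [prod0|prod1].
  rewrite prod0; have [y yA Gy] := fset_prod_eq0 prod0.
  by rewrite (fset_prod_zero yA) // -GH //; left.
have G1 := fset_prod_eq1 G01 prod1.
by rewrite prod1 fset_prod_one // => y yA; rewrite -GH ?G1 //; right.
Qed.

(** If the product is nonzero, so are all cofactors; a zero maximum then kills every [Z y], so each
    [G y] is 0 or 1, hence 1. Conversely, a zero factor at x annihilates all cofactors except that
    of x, where [Z x = 0]; and if the product is 1, every Z vanishes. With U_n as cofactor, this is
    the induction step for Z_n. *)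
Lemma max_cofactor_eq0 (R : realType) (A : {fset word}) (G Z : word -> R) :
  (forall y, y \in A -> 0 <= G y <= 1) ->
  (forall y, y \in A -> 0 <= Z y) ->
  (forall y, y \in A -> Z y = 0 <-> in01 (G y)) ->
  \big[Num.max/0]_(y <- A) ((\prod_(z <- (A `\ y)%fset) G z) ^+ 2 * Z y) = 0
  <-> in01 (\prod_(y <- A) G y).
Proof.
move=> G01 Z0 ZG.
rewrite fset_bigmax_eq0; last by move=> y yA; rewrite mulr_ge0 ?sqr_ge0 ?Z0.
split=> [UZ0|[prod0|prod1] y yA].
- have [prod0|prod_neq0] := eqVneq (\prod_(y <- A) G y) 0; [by left|right].
  apply: fset_prod_one => y yA.
  move: prod_neq0; rewrite (big_fsetD1 y) //= mulf_eq0 negb_or => /andP[Gy U].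
  have /eqP := UZ0 y yA; rewrite mulf_eq0 expf_eq0 (negbTE U) andbF /=.
  by move=> /eqP/(ZG y yA)[Gy0|//]; rewrite Gy0 eqxx in Gy.
- have [x xA Gx] := fset_prod_eq0 prod0.
  have [->|yx] := eqVneq y x; first by rewrite (ZG x xA).2 ?mulr0 //; left.
  rewrite (@fset_prod_zero _ (A `\ y)%fset _ x) ?expr0n ?mul0r //.
  by rewrite in_fsetD1 eq_sym yx.
- by rewrite (ZG y yA).2 ?mulr0 //; right; apply: (fset_prod_eq1 G01).
Qed.

(** * Minimax values as products *)

Lemma minimax_prod (R : realType) (T : {fset word}) (o : word -> R) (x : word) :
  Cset T x != fset0 -> (forall y, y \in Cset T x -> in01 (minimax T o y)) ->
  minimax T o x =
  toward (t x) (\prod_(y <- Cset T x) toward (t x) (minimax T o y)).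
Proof.
move=> Cx R01; rewrite minimax_node //; case: (t x) => /=.
  rewrite [LHS]big_seq [in RHS]big_seq.
  (* Maximum and product are folded together. The fold must also record that the partial maximum is
     0 or 1, since max(a,b) = 1 - (1-a)(1-b) can fail for other values. The default maximum 0
     matches the empty product 1. *)
  have [] : let u := \big[Num.max/0]_(y <- Cset T x | y \in Cset T x) minimax T o y in
    let v := \prod_(y <- Cset T x | y \in Cset T x) (1 - minimax T o y) in
    u = 1 - v /\ in01 u; last by [].
  apply: (big_rec2 (fun u v => u = 1 - v /\ in01 u)).
    by rewrite subrr; split=> //; left.
  move=> y u v /R01 y01 [uE u01].
  have -> : v = 1 - u by rewrite uE opprB addrC subrK.
  by case: y01 => ->; case: u01 => -> {uE};
    rewrite ?subr0 ?subrr ?mul0r ?mul1r ?subr0 ?subrr ?maxxx ?(max_l ler01)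
      ?(max_r ler01); split=> //; [left|right|right|right].
rewrite [LHS]big_seq [in RHS]big_seq.
have [] : let u := \big[Num.min/1]_(y <- Cset T x | y \in Cset T x) minimax T o y in
  let v := \prod_(y <- Cset T x | y \in Cset T x) minimax T o y in
  u = v /\ in01 u; last by [].
apply: (big_rec2 (fun u v => u = v /\ in01 u)); first by split=> //; right.
move=> y u v /R01 y01 [<- u01].
by case: y01 => ->; case: u01 => ->;
  rewrite ?mul0r ?mul1r ?minxx ?(min_l ler01) ?(min_r ler01);
  split=> //; [left|left|left|right].
Qed.

Lemma minimax_in01 (R : realType) (T : {fset word}) (o : word -> R) (x : word) :
  is_subtree T -> (forall x, x \in leaves T -> in01 (o x)) -> x \in T ->
  in01 (minimax T o x).
Proof.
move=> hT ho; have [k] := ubnP (levels_below T x).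
elim: k x => // k IH x; rewrite ltnS => lk xT.
have [C0|Cx] := eqVneq (Cset T x) fset0.
  have xL : x \in leaves T by rewrite leavesE // C0.
  by rewrite minimax_leaf //; apply: ho.
have R01 y : y \in Cset T x -> in01 (minimax T o y).
  move=> yC; apply: IH; first by rewrite -(levels_below_child yC).
  by move: yC; rewrite mem_Cset => /andP[].
rewrite minimax_prod //; apply/toward_in01/fset_prod_in01 => y yC.
by apply/toward_in01/R01.
Qed.

(** * Invariants of R_n and Z_n, and the argmax descent *)

Section Search.
Context (R : realType) (T : {fset word}) (o : word -> R)
  (m s : {fset word} -> word -> R)
  (hT : is_subtree T)
  (ho : forall x, x \in leaves T -> in01 (o x))
  (hm : forall S x,
     is_subtree S -> (S `<=` T)%fset -> x \in leaves S -> 0 <= m S x <= 1)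
  (hs : forall S x,
     is_subtree S -> (S `<=` T)%fset -> x \in leaves S -> 0 <= s S x)
  (hms : forall S x,
     is_subtree S -> (S `<=` T)%fset ->
     Dset T (leaves S) = fset0 -> x \in leaves S ->
     (s S x = 0 <-> in01 (m S x)) /\ (in01 (m S x) -> m S x = minimax T o x)).

Lemma Rn_prod (xs : {fset word}) (x : word) :
  x \notin xs -> x \notin Dset T xs -> Cset T x != fset0 ->
  Rn T o m xs x =
  toward (t x) (\prod_(y <- Cset T x) toward (t x) (Rn T o m xs y)).
Proof. by move=> *; rewrite Rn_node // /toward; case: (t x). Qed.

Lemma Un_child (xs : {fset word}) (x y : word) : y \in Cset T x ->
  Un T o m xs y =
  \prod_(z <- (Cset T x `\ y)%fset) toward (t x) (Rn T o m xs z).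
Proof.
move=> yC; rewrite /Un (Hset_child yC) /toward.
by move: yC; rewrite mem_Cset => /andP[_ /childof_father ->]; case: (t x).
Qed.

(** The four clauses are proved together: the equivalence for Z_n at x needs the bounds on R_n and
    the sign of Z_n at the children. The induction is on [levels_below], which drops by one at each
    child. *)
Lemma Rn_Zn_invariant (xs : {fset word}) (x : word) :
  {subset xs <= leaves T} -> x \in branches xs \/ x \in Dset T xs ->
  [/\ 0 <= Rn T o m xs x <= 1, 0 <= Zn T o m s xs x,
      Zn T o m s xs x = 0 <-> in01 (Rn T o m xs x) &
      in01 (Rn T o m xs x) -> Rn T o m xs x = minimax T o x].
Proof.
move=> xsL; have xsT : {subset xs <= T} by move=> y /xsL /leaf_mem.
have [k] := ubnP (levels_below T x).
elim: k x => // k IH x; rewrite ltnS => lk xBD.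
have xT := sub_branches_D hT xsT xBD.
have [xxs|xxs] := boolP (x \in xs).
  have x01 := minimax_in01 hT ho xT.
  by rewrite Rn_visited // Zn_visited // lexx in01_itv.
have [xD|xD] := boolP (x \in Dset T xs).
  have hK := Kset_subtree x hT; have xK := leaf_Kset hT xT.
  rewrite Rn_D // Zn_D //.
  have [sm mR] := hms hK (Kset_sub T x) (Dset_leaves_Kset x hT) xK.
  by split=> //; [apply: hm|apply: hs]; rewrite ?Kset_sub.
have xB : x \in branches xs by case: xBD => // xD'; rewrite xD' in xD.
have [_ Cx CBD] := branches_child hT xsT xB xxs.
have IHc y : y \in Cset T x ->
  [/\ 0 <= Rn T o m xs y <= 1, 0 <= Zn T o m s xs y,
      Zn T o m s xs y = 0 <-> in01 (Rn T o m xs y) &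
      in01 (Rn T o m xs y) -> Rn T o m xs y = minimax T o y].
  by move=> yC; apply: IH (CBD y yC); rewrite -(levels_below_child yC).
have G01 y : y \in Cset T x -> 0 <= toward (t x) (Rn T o m xs y) <= 1.
  by case/IHc => y01 _ _ _; apply: toward_itv.
rewrite Rn_prod // Zn_node //; split.
- exact/toward_itv/fset_prod_itv.
- by elim/big_rec: _ => // y u _ u0; rewrite le_max u0 orbT.
(* The recursion for Z_n is the cofactor maximum, once each U_n is written as the product over the
   other children of x. *)
- rewrite toward_in01 -(@max_cofactor_eq0 _ _ _ (Zn T o m s xs)) //.
  + by rewrite big_seq [X in _ <-> X = 0]big_seq;
      under eq_bigr => y yC do rewrite (Un_child xs yC).
  + by move=> y /IHc[].
  + by move=> y /IHc[_ _ ZR _]; rewrite toward_in01.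
- move=> /toward_in01 prod01; rewrite minimax_prod //; last first.
    move=> y; rewrite mem_Cset => /andP[yT _]; exact: minimax_in01.
  congr toward; apply: fset_prod_in01_transfer => // y /IHc[_ _ _ RM].
  by move=> /toward_in01/RM ->.
Qed.

Lemma selects_branches_D (xs : {fset word}) (z w : word) :
  selects T o m s xs z w -> w \in xs \/ w \in Dset T xs.
Proof. by elim. Qed.

(** A nonzero Z_n propagates down the descent: were it 0 at the chosen child, maximality and
    nonnegativity would make all the U_n^2 Z_n vanish, hence also Z_n at the parent. The descent
    cannot end at a visited node, where Z_n is 0. *)
Lemma selects_unexplored (xs : {fset word}) (z w : word) :
  {subset xs <= leaves T} -> selects T o m s xs z w ->
  z \in branches xs \/ z \in Dset T xs -> Zn T o m s xs z <> 0 ->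
  w \in Dset T xs.
Proof.
move=> xsL; have xsT : {subset xs <= T} by move=> y /xsL /leaf_mem.
elim=> {z w} [z [zxs _ /(_ (Zn_visited _ _ _ _ zxs))|//]|z y w zN yC ymax _ IH zBD Zz].
  by [].
have zxs : z \notin xs by apply/negP => ?; apply: zN; left.
have zD : z \notin Dset T xs by apply/negP => ?; apply: zN; right.
have zB : z \in branches xs by case: zBD => // zD'; rewrite zD' in zD.
have [_ Cz CBD] := branches_child hT xsT zB zxs.
apply: IH; first exact: CBD.
move=> Zy; apply: Zz; rewrite Zn_node // fset_bigmax_eq0 => y' y'C.
  apply/eqP; rewrite eq_le; have := ymax _ y'C; rewrite Zy mulr0 => ->.
  by rewrite mulr_ge0 ?sqr_ge0 //; have [] := Rn_Zn_invariant xsL (CBD _ y'C).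
by rewrite mulr_ge0 ?sqr_ge0 //; have [] := Rn_Zn_invariant xsL (CBD _ y'C).
Qed.

End Search.

(** * Visited leaves, performed steps and termination *)

Lemma mem_visited (x : nat -> word) (n : nat) (y : word) :
  reflect (exists2 k, (1 <= k <= n)%N & y = x k) (y \in visited x n).
Proof.
by apply: (iffP (imfsetP _ _ _ _)) => -[k kn ->]; exists k => //;
  move: kn; rewrite /= -/(iota 1 n) mem_iota add1n ltnS.
Qed.

Lemma performed_le (R : realType) (T : {fset word}) (o : word -> R)
    (m : {fset word} -> word -> R) (x : nat -> word) (k n : nat) :
  (k <= n)%N -> performed T o m x n -> performed T o m x k.
Proof.
by move=> kn H i /andP[i2 ik]; apply: H; rewrite i2 (leq_trans ik kn).
Qed.

Lemma performedS (R : realType) (T : {fset word}) (o : word -> R)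
    (m : {fset word} -> word -> R) (x : nat -> word) (n : nat) :
  performed T o m x n -> ~ in01 (Rn T o m (visited x n) rootnode) ->
  performed T o m x n.+1.
Proof.
move=> H Hn k /andP[k2]; rewrite ltnS leq_eqVlt => /predU1P[-> //|kn].
by apply: H; rewrite k2 kn.
Qed.

(** Pigeonhole: the first n values are pairwise distinct, which is impossible for n = |A| + 1. *)
Lemma new_values_bounded (x : nat -> word) (A : {fset word}) :
  (forall n, (1 <= n)%N -> x n \in A) ->
  ~ (forall n, (1 <= n)%N -> x n.+1 \notin visited x n).
Proof.
move=> xA xnew; have card n : #|` visited x n| = n.
  elim: n => [|n IH]; first by apply/eqP; rewrite cardfs_eq0; apply/eqP/fsetP => y;
    rewrite in_fset0; apply/negP => /mem_visited[k]; case: k.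
  have -> : visited x n.+1 = (x n.+1 |` visited x n)%fset.
    apply/fsetP => y; rewrite in_fset1U; apply/mem_visited/predU1P.
      move=> [k /andP[k1]]; rewrite leq_eqVlt => /predU1P[-> ->|kn ->]; [by left|right].
      by apply/mem_visited; exists k => //; rewrite k1.
    move=> [->|/mem_visited[k /andP[k1 kn] ->]]; first by exists n.+1; rewrite ?leqnn.
    by exists k => //; rewrite k1 ltnW.
  (* Newness is assumed only from the second value on; the first one is new because nothing has been
     visited yet. *)
  rewrite cardfsU1 IH; case: (posnP n) => [->|n1]; last by rewrite xnew.
  by case: mem_visited => // -[[]].
have : (visited x #|` A|.+1 `<=` A)%fset.
  by apply/fsubsetP => y /mem_visited[k /andP[k1 _] ->]; apply: xA.
by move=> /fsubset_leq_card; rewrite card ltnn.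
Qed.

(** * Conclusion, realization by realization *)

Theorem proposition15 (R : realType) (T : {fset word}) (o : word -> R)
    (m s : {fset word} -> word -> R)
    (hT : is_subtree T)
    (ho : forall x : word, x \in leaves T -> in01 (o x))
    (hm : forall (S : {fset word}) (x : word),
       is_subtree S -> (S `<=` T)%fset -> x \in leaves S -> 0 <= m S x <= 1)
    (hs : forall (S : {fset word}) (x : word),
       is_subtree S -> (S `<=` T)%fset -> x \in leaves S -> 0 <= s S x)
    (hms : forall (S : {fset word}) (x : word),
       is_subtree S -> (S `<=` T)%fset ->
       Dset T (leaves S) = fset0 -> x \in leaves S ->
       (s S x = 0 <-> in01 (m S x)) /\ (in01 (m S x) -> m S x = minimax T o x))
    (d : measure_display) (Omega : measurableType d) (P : probability Omega R)
    (X Z : Omega -> nat -> word)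
    (hX : is_algorithm P T o m s X Z) :
  forall w : Omega,
    (forall n, (1 <= n)%N -> performed T o m (X w) n ->
       ~ in01 (Rn T o m (visited (X w) n) rootnode) ->
       X w n.+1 \notin visited (X w) n)
    /\ (exists n0, (1 <= n0)%N /\ performed T o m (X w) n0 /\
          in01 (Rn T o m (visited (X w) n0) rootnode))
    /\ (forall n0, (1 <= n0)%N -> performed T o m (X w) n0 ->
          in01 (Rn T o m (visited (X w) n0) rootnode) ->
          Rn T o m (visited (X w) n0) rootnode = minimax T o rootnode).
Proof.
move=> w.
(* Strong induction is needed because a step that selects a visited node repeats a leaf of arbitrary
   earlier index. *)
have leafX n : (1 <= n)%N -> performed T o m (X w) n -> X w n \in leaves T.
  elim/ltn_ind: n => -[//|[|n]] IH _ perf; first exact: (alg_first hX).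
  case: (selects_branches_D (alg_select hX (ltn0Sn n) perf)) => [zV|zD].
    rewrite (alg_again hX (ltn0Sn n) perf zV).
    have /mem_visited[k /andP[k1 kn] ->] := zV.
    by apply: IH => //; apply: performed_le perf; apply: ltnW.
  by have [] := alg_match hX (ltn0Sn n) perf zD.
have visitedL n : performed T o m (X w) n ->
    {subset visited (X w) n <= leaves T}.
  move=> perf y /mem_visited[k /andP[k1 kn] ->].
  exact: leafX (performed_le kn perf).
have rootB n : (1 <= n)%N -> rootnode \in branches (visited (X w) n).
  move=> n1; apply: (@mem_branches_root _ (X w 1)).
  by apply/mem_visited; exists 1.
have new n : (1 <= n)%N -> performed T o m (X w) n ->
    ~ in01 (Rn T o m (visited (X w) n) rootnode) ->
    X w n.+1 \notin visited (X w) n.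
  move=> n1 perf root01; have perfS := performedS perf root01.
  have rBD : rootnode \in branches (visited (X w) n) \/
    rootnode \in Dset T (visited (X w) n) by left; apply: rootB.
  have [_ _ ZR _] := Rn_Zn_invariant hT ho hm hs hms (visitedL n perf) rBD.
  have zD := selects_unexplored hT ho hm hs hms (visitedL n perf)
    (alg_select hX n1 perfS) rBD (fun Z0 => root01 (ZR.1 Z0)).
  have [_ zx] := alg_match hX n1 perfS zD.
  (* The new leaf is below the selected node; if it had been visited already, that node would lie on
     a branch, contrary to its being in D. *)
  apply/negP => xV; have /mem_Dset[_ /negP[]] := zD.
  by apply/mem_branches; exists (X w n.+1).
split=> //; split; last first.
  move=> n n1 perf root01.
  by have [_ _ _ ->] := Rn_Zn_invariant hT ho hm hs hms (visitedL n perf)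
    (or_introl (rootB n n1)).
(* If the root were never decided, every step would be performed and would produce a new leaf,
   contradicting the finiteness of the set of leaves. *)
apply: contrapT => never.
have perf n : performed T o m (X w) n.
  elim: n => [|n IH]; first by move=> k; rewrite ltn0 andbF.
  (* [never] speaks of n >= 1 only, so step 1 is treated apart: the stopping test starts at index 2
     and its condition is vacuous there. *)
  case: n IH => [|n] IH; first by move=> k /andP[k2]; rewrite ltnNge ltnW.
  by apply: performedS => // root01; apply: never; exists n.+1.
apply: (@new_values_bounded (X w) (leaves T)) => n n1; first exact: leafX.
by apply: new => // root01; apply: never; exists n.
Qed.
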